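(* Let $F$ be a field, let $G_1,G_2$ be groups and let $n_1,n_2\in\mathbb N$. Fix tuples $\gamma_i=(g_{i1},\dots,g_{in_i})$ where $g_{ij}\in G_i$, finite subgroups $H_i\subseteq G_i$, and $2$-cocycles $\sigma_i\in Z^2(H_i,F^\times)$, $i=1,2$. The gradings on $M(\gamma_1,\sigma_1)$ and $M(\gamma_2,\sigma_2)$ are weakly equivalent if and only if they satisfy the following Condition ( * ): $n_1=n_2$, and there exist a group isomorphism $\alpha\colon H_1\to H_2$, a permutation $\pi\in S_{n_1}$, and elements $t_i\in H_2$, $1\leqslant i\leqslant n_1$, such that $[\sigma_1]=[\sigma_2(\alpha(\cdot),\alpha(\cdot))]$ and for every $1\leqslant i,j,k,\ell\leqslant n_1$ and $h_1,h_2\in H_1$ we have $$g_{2,\pi(i)}t_i\alpha(h_1)t_j^{-1}g_{2,\pi(j)}^{-1}=g_{2,\pi(k)}t_k\alpha(h_2)t_\ell^{-1}g_{2,\pi(\ell)}^{-1}$$ if and only if $$g_{1i}h_1g_{1j}^{-1}=g_{1k}h_2g_{1\ell}^{-1}.$$ If $M(\gamma_1,\sigma_1)$ and $M(\gamma_2,\sigma_2)$ satisfy Condition ( * ), the algebra isomorphism $\varphi\colon M(\gamma_1,\sigma_1)\to M(\gamma_2,\sigma_2)$ implementing this weak equivalence can be defined e.g. by $$\varphi(e_{ij}\otimes x_h)=e_{\pi(i),\pi(j)}\otimes y_{t_i\alpha(h)t_j^{-1}},$$ where $(x_h)_{h\in H_1}$ is the formal basis in $F^{\sigma_1}H_1$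 and $(y_t)_{t\in H_2}$ is the formal basis in $F^{\sigma_2}H_2$.
   Context: All group actions on $F^\times$ (the multiplicative group of $F$) are trivial. $Z^2(H,F^\times)$ is the group of functions $\sigma\colon H\times H\to F^\times$ with $\sigma(u,v)\sigma(uv,w)=\sigma(u,vw)\sigma(v,w)$ for all $u,v,w\in H$ ($2$-cocycles); $H^2(H,F^\times)$ is its quotient by the subgroup of $2$-cocycles of the form $(g,h)\mapsto\tau(g)\tau(h)\tau(gh)^{-1}$ with $\tau\colon H\to F^\times$ a map; $[\sigma]$ is the class of $\sigma$ in $H^2(H,F^\times)$. For a homomorphism $\alpha\colon H_1\to H_2$ and $\sigma\in Z^2(H_2,F^\times)$, $[\sigma(\alpha(\cdot),\alpha(\cdot))]$ is the class of the $2$-cocycle $(g,h)\mapsto\sigma(\alpha(g),\alpha(h))$ on $H_1$. The twisted group algebra $F^\sigma H$ is the associative algebra with formal basis $(u_h)_{h\in H}$ and multiplication $u_gu_h=\sigma(g,h)u_{gh}$. For a group $G$, a tuple $\gamma=(g_1,\dots,g_n)$ of elements of $G$, a finite subgroup $H\subseteq G$ and $\sigma\in Z^2(H,F^\times)$, $M(\gamma,\sigma)$ is the algebra $M_n(F)\otimes_F F^\sigma H$ endowed with the $G$-grading in which $e_{ij}\otimes u_h$ belongs to the $g_ihg_j^{-1}$-component, where $e_{ij}$ are the matrix units. Two gradings $A=\bigoplus_{s\in S}A^{(s)}$ and $B=\bigoplus_{t\in T}B^{(t)}$ are weakly equivalent if there exists an algebra isomorphism $\varphi\colon A\to B$ such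 that for every $s\in S$ with $A^{(s)}\neq 0$ there exists $t\in T$ with $\varphi(A^{(s)})=B^{(t)}$; such a $\varphi$ is said to implement the weak equivalence.
   Formalization: The printed formula for φ is not multiplicative in general (σ_1, σ_2∘α are only cohomologous); it is proved with explicit nonzero scalars τ(h)σ_2(t_i,α(h))/σ_2(t_iα(h)t_j^{-1},t_j) inserted, and as printed whenever it defines an algebra homomorphism. *)

(* Defs.v *)
From HB Require Import structures.
From mathcomp Require Import all_boot all_order all_algebra all_fingroup all_field.
From mathcomp Require Import finmap.

Set Implicit Arguments.
Unset Strict Implicit.
Unset Printing Implicit Defensive.

Import GRing.Theory.
Local Open Scope ring_scope.

(* Finite subgroups of a possibly infinite group.  The element type of such a
   subgroup is a finGroupType whose [val] is the inclusion into G. *)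
Record finsubgroup (G : groupType) := FinSubgroup {
  fsg_set : {fset G};
  fsg_closed : group_closed (fun x : G => x \in fsg_set)
}.

Definition fsg_elt (G : groupType) (H : finsubgroup G) : predArgType :=
  fset_sub_type (fsg_set H).
Coercion fsg_elt : finsubgroup >-> predArgType.

Section FinSubgroupStructure.
Variables (G : groupType) (H : finsubgroup G).
HB.instance Definition _ := SubChoice.on (fsg_elt H).
HB.instance Definition _ := Finite.on (fsg_elt H).
HB.instance Definition _ :=
  SubChoice_isSubGroup.Build G _ (fsg_elt H) (fsg_closed H).
End FinSubgroupStructure.

(* Values in F^x are encoded as nonzero elements of F. *)
Record cocycle2 (H : groupType) (F : fieldType) := Cocycle2 {
  cocycle2_fun :> H -> H -> F;
  cocycle2_neq0 : forall u v, cocycle2_fun u v != 0;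
  cocycle2P : forall u v w,
    cocycle2_fun u v * cocycle2_fun (u * v)%g w =
    cocycle2_fun u (v * w)%g * cocycle2_fun v w
}.

Section Cohomology.
Variable F : fieldType.

(* [s1 = s2 * d tau] *)
Definition cobounds (H : groupType) (s1 s2 : cocycle2 H F) (tau : H -> F) :=
  (forall g, tau g != 0) /\
  (forall g h, s1 g h = s2 g h * (tau g * tau h * (tau (g * h)%g)^-1)).

(* Equality of classes in H^2(H, F^x). *)
Definition cohomologous (H : groupType) (s1 s2 : cocycle2 H F) :=
  exists tau, cobounds s1 s2 tau.

Variables (H1 H2 : groupType) (alpha : {multiplicative H1 -> H2}).
Variable s : cocycle2 H2 F.

Fact pullback_neq0 u v : s (alpha u) (alpha v) != 0.
Proof. exact: cocycle2_neq0. Qed.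

Fact pullbackP u v w :
  s (alpha u) (alpha v) * s (alpha (u * v)%g) (alpha w) =
  s (alpha u) (alpha (v * w)%g) * s (alpha v) (alpha w).
Proof. by rewrite !gmulfM cocycle2P. Qed.

Definition cocycle_pullback : cocycle2 H1 F :=
  Cocycle2 pullback_neq0 pullbackP.

End Cohomology.

(* The twisted group algebra F^s H: an element is its family of coordinates in
   the formal basis (u_h); [twgalg_basisM] is the defining multiplication
   rule.  As s need not be normalized, the unit is s(1,1)^-1 u_1. *)
Definition twgalg (F : fieldType) (H : finGroupType) (s : cocycle2 H F) :=
  {ffun H -> F^o}.

Section TwistedGroupAlgebra.
Variables (F : fieldType) (H : finGroupType) (s : cocycle2 H F).
Local Notation A := (twgalg s).

HB.instance Definition _ := GRing.Lmodule.on A.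
HB.instance Definition _ := Vector.on A.

Definition twgalg_basis (h : H) : A := [ffun g => (g == h)%:R].

Definition twgalg_one : A := (s 1%g 1%g)^-1 *: twgalg_basis 1%g.
Definition twgalg_mul (x y : A) : A :=
  [ffun h => \sum_g s g (g^-1 * h)%g * (x g * y (g^-1 * h)%g)].

Fact cocycle2_1l h : s 1%g h = s 1%g 1%g.
Proof.
have := cocycle2P s 1%g 1%g h; rewrite !mul1g => /(mulIf _) -> //.
exact: cocycle2_neq0.
Qed.

Fact cocycle2_1r h : s h 1%g = s 1%g 1%g.
Proof.
have := cocycle2P s h 1%g 1%g; rewrite !mulg1 => /(mulfI _) -> //.
exact: cocycle2_neq0.
Qed.

Fact twgalg_mulA : associative twgalg_mul.
Proof.
move=> x y z; apply/ffunP=> h; rewrite !ffunE.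
under eq_bigr => a _ do rewrite ffunE !big_distrr /=.
under [RHS]eq_bigr => c _ do rewrite ffunE big_distrl big_distrr /=.
rewrite [RHS]exchange_big; apply: eq_bigr => a _ /=.
rewrite (reindex_inj (mulgI a^-1)%g); apply: eq_bigr => c _ /=.
rewrite invMg invgK mulgA mulgK.
have := cocycle2P s a (a^-1 * c)%g (c^-1 * h)%g.
rewrite -!mulgA !mulKVg => E.
rewrite mulrCA [s a _ * (_ * _)]mulrA -E mulrCA -!mulrA.
exact: mulrCA.
Qed.

Fact twgalg_mul1 : left_id twgalg_one twgalg_mul.
Proof.
move=> x; apply/ffunP=> h; rewrite ffunE (bigD1 1%g) //= big1 ?addr0.
  rewrite !ffunE eqxx invg1 mul1g cocycle2_1l [_ *: _]mulr1 mulrA divff ?mul1r //.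
  exact: cocycle2_neq0.
move=> g /negbTE g1; rewrite !ffunE g1.
by rewrite [_ *: _]mulr0 mul0r mulr0.
Qed.

Fact twgalg_mulr1 : right_id twgalg_one twgalg_mul.
Proof.
move=> x; apply/ffunP=> h; rewrite ffunE (bigD1 h) //= big1 ?addr0.
  rewrite mulVg !ffunE eqxx cocycle2_1r [_ *: _]mulr1 mulrCA divff ?mulr1 //.
  exact: cocycle2_neq0.
move=> g gh; rewrite !ffunE -(inj_eq (mulgI g)) mulKVg mulg1 eq_sym (negbTE gh).
by rewrite [_ *: _]mulr0 !mulr0.
Qed.

Fact twgalg_mulDl : left_distributive twgalg_mul +%R.
Proof.
move=> x y z; apply/ffunP=> h; rewrite !ffunE -big_split /=.
by apply: eq_bigr => g _; rewrite !ffunE mulrDl mulrDr.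
Qed.

Fact twgalg_mulDr : right_distributive twgalg_mul +%R.
Proof.
move=> x y z; apply/ffunP=> h; rewrite !ffunE -big_split /=.
by apply: eq_bigr => g _; rewrite !ffunE !mulrDr.
Qed.

Fact twgalg_one_neq0 : twgalg_one != 0.
Proof.
apply/eqP => /ffunP /(_ 1%g) /eqP; rewrite !ffunE eqxx [_ *: _]mulr1.
by rewrite invr_eq0; apply/negP/cocycle2_neq0.
Qed.

HB.instance Definition _ := GRing.Zmodule_isNzRing.Build A
  twgalg_mulA twgalg_mul1 twgalg_mulr1 twgalg_mulDl twgalg_mulDr
  twgalg_one_neq0.

Fact twgalg_scaleAl (k : F) (x y : A) : k *: (x * y) = (k *: x) * y.
Proof.
apply/ffunP=> h; rewrite !ffunE scaler_sumr; apply: eq_bigr => g _.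
by rewrite !ffunE [k *: _]mulrCA [k *: x g]/(k * x g) !mulrA.
Qed.
HB.instance Definition _ := GRing.Lmodule_isLalgebra.Build F A twgalg_scaleAl.

Fact twgalg_scaleAr (k : F) (x y : A) : k *: (x * y) = x * (k *: y).
Proof.
apply/ffunP=> h; rewrite !ffunE scaler_sumr; apply: eq_bigr => g _.
by rewrite !ffunE [k *: _]mulrCA; congr (_ * _); rewrite mulrCA.
Qed.
HB.instance Definition _ := GRing.Lalgebra_isAlgebra.Build F A twgalg_scaleAr.
HB.instance Definition _ := Algebra_isFalgebra.Build F A.

Lemma twgalg_basisM g h :
  twgalg_basis g * twgalg_basis h = s g h *: twgalg_basis (g * h)%g.
Proof.
apply/ffunP=> k; rewrite !ffunE (bigD1 g) //= big1 ?addr0.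
  rewrite !ffunE eqxx mul1r -(inj_eq (mulgI g)) mulKVg.
  by case: eqP => [->|_]; rewrite ?mulKg // mulr0 [_ *: _]mulr0.
by move=> a /negbTE ag; rewrite !ffunE ag mul0r mulr0.
Qed.

Lemma twgalg_basis_expand (x : A) : x = \sum_h x h *: twgalg_basis h.
Proof.
apply/ffunP=> k; rewrite sum_ffunE (bigD1 k) //= big1 ?addr0.
  by rewrite !ffunE eqxx [_ *: _]mulr1.
by move=> a ak; rewrite !ffunE eq_sym (negbTE ak) [_ *: _]mulr0.
Qed.

End TwistedGroupAlgebra.

Arguments twgalg_basis {F H} s h.

Lemma twgalg_basis_unit (F : fieldType) (H : finGroupType) (s : cocycle2 H F) h :
  twgalg_basis s h \is a GRing.unit.
Proof.
apply/unitrP; exists ((s h^-1%g h * s 1%g 1%g)^-1 *: twgalg_basis s h^-1%g).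
have E : s h h^-1%g = s h^-1%g h.
  have := cocycle2P s h h^-1%g h; rewrite mulVg mulgV cocycle2_1l cocycle2_1r mulrC.
  by apply/mulfI/cocycle2_neq0.
rewrite -scalerAl -scalerAr !twgalg_basisM mulVg mulgV E.
rewrite !scalerA invfM mulrAC mulVf ?mul1r //; exact: cocycle2_neq0.
Qed.

(* M_n(F) (x)_F A, for n = n'.+1, realized as the algebra of n x n matrices over
   A with F acting entrywise; a pure tensor is [mxtens M a].  Being n x n
   matrices with the usual product, it inherits its ring structure. *)
Definition mxalg (F : fieldType) (A : falgType F) (n : nat) := 'M[A]_n.+1.

Section MatrixTensor.
Variables (F : fieldType) (A : falgType F) (n : nat).
Local Notation M := (mxalg A n).

HB.instance Definition _ := GRing.NzRing.on M.

Definition mxalg_scale (k : F) (x : M) : M := map_mx ( *:%R k) x.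

Fact mxalg_scaleA a b x : mxalg_scale a (mxalg_scale b x) = mxalg_scale (a * b) x.
Proof. by apply/matrixP=> i j; rewrite !mxE scalerA. Qed.
Fact mxalg_scale1 : left_id 1 mxalg_scale.
Proof. by move=> x; apply/matrixP=> i j; rewrite !mxE scale1r. Qed.
Fact mxalg_scaleDr : right_distributive mxalg_scale +%R.
Proof. by move=> k x y; apply/matrixP=> i j; rewrite !mxE scalerDr. Qed.
Fact mxalg_scaleDl x : {morph mxalg_scale^~ x : a b / a + b}.
Proof. by move=> a b; apply/matrixP=> i j; rewrite !mxE scalerDl. Qed.

HB.instance Definition _ := GRing.Zmodule_isLmodule.Build F M
  mxalg_scaleA mxalg_scale1 mxalg_scaleDr mxalg_scaleDl.

Fact mxalg_scaleAl (k : F) (x y : M) : k *: (x * y) = (k *: x) * y.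
Proof.
apply/matrixP=> i j; rewrite !mxE scaler_sumr; apply: eq_bigr => l _.
by rewrite !mxE scalerAl.
Qed.
HB.instance Definition _ := GRing.Lmodule_isLalgebra.Build F M mxalg_scaleAl.

Fact mxalg_scaleAr (k : F) (x y : M) : k *: (x * y) = x * (k *: y).
Proof.
apply/matrixP=> i j; rewrite !mxE scaler_sumr; apply: eq_bigr => l _.
by rewrite !mxE scalerAr.
Qed.
HB.instance Definition _ := GRing.Lalgebra_isAlgebra.Build F M mxalg_scaleAr.

Fact mxalg_vect_iso : Vector.axiom (dim {ffun 'I_n.+1 * 'I_n.+1 -> A}) M.
Proof.
pose f (x : M) : {ffun 'I_n.+1 * 'I_n.+1 -> A} := [ffun p => x p.1 p.2].
pose f' (v : {ffun 'I_n.+1 * 'I_n.+1 -> A}) : M := \matrix_(i, j) v (i, j).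
have [g [gZ gD] g_bij] :=
  VectorInternalTheory.v2r_subproof {ffun 'I_n.+1 * 'I_n.+1 -> A}.
exists (g \o f).
  move=> k x y /=; rewrite -gZ -gD; congr g.
  by apply/ffunP=> p; rewrite !ffunE !mxE.
apply: bij_comp g_bij _; exists f' => [x|v].
  by apply/matrixP=> i j; rewrite mxE ffunE.
by apply/ffunP=> -[i j]; rewrite ffunE mxE.
Qed.
HB.instance Definition _ := Lmodule_hasFinDim.Build F M mxalg_vect_iso.
HB.instance Definition _ := Algebra_isFalgebra.Build F M.

Definition mxtens (x : 'M[F]_n.+1) (a : A) : M := \matrix_(i, j) (x i j *: a).

Lemma mxtens_linearl a k x y : mxtens (k *: x + y) a = k *: mxtens x a + mxtens y a.
Proof. by apply/matrixP=> i j; rewrite !mxE scalerDl scalerA. Qed.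

Lemma mxtens_linearr x k a b : mxtens x (k *: a + b) = k *: mxtens x a + mxtens x b.
Proof. by apply/matrixP=> i j; rewrite !mxE scalerDr !scalerA mulrC. Qed.

Lemma mxtensM x y a b : mxtens x a * mxtens y b = mxtens (x * y) (a * b).
Proof.
apply/matrixP=> i j; rewrite !mxE scaler_suml; apply: eq_bigr => l _.
by rewrite !mxE -scalerAl -scalerAr scalerA.
Qed.

Lemma mxtens1 : mxtens 1 1 = 1.
Proof. by apply/matrixP=> i j; rewrite !mxE; case: eqP; rewrite ?scale1r ?scale0r. Qed.

Lemma mxtens_expand (x : M) : x = \sum_i \sum_j mxtens (delta_mx i j) (x i j).
Proof.
apply/matrixP=> i j.
have [ev evE] : exists ev : M -> A, forall y, ev y = y i j by exists (fun y => y i j).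
have evD : {morph ev : y z / y + z} by move=> y z; rewrite !evE mxE.
have ev0 : ev 0 = 0 by rewrite evE mxE.
rewrite -[RHS]evE (big_morph ev evD ev0) (bigD1 i) //= [X in _ + X]big1.
  rewrite addr0 (big_morph ev evD ev0) (bigD1 j) //= [X in _ + X]big1.
    by rewrite addr0 evE !mxE !eqxx scale1r.
  by move=> l lj; rewrite evE !mxE [j == l]eq_sym (negbTE lj) andbF scale0r.
move=> k ki; rewrite (big_morph ev evD ev0) big1 // => l _.
by rewrite evE !mxE [i == k]eq_sym (negbTE ki) scale0r.
Qed.

End MatrixTensor.

Section WeakEquivalence.
Variables (F : fieldType) (A B : falgType F) (S T : Type).
Variables (gA : S -> {vspace A}) (gB : T -> {vspace B}).

Definition implements_weak_equivalence (phi : {lrmorphism A -> B}) :=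
  bijective phi /\
  forall s, gA s != 0%VS -> exists t, (linfun phi @: gA s)%VS = gB t.

Definition weakly_equivalent :=
  exists phi : {lrmorphism A -> B}, implements_weak_equivalence phi.

End WeakEquivalence.

(* M(gamma, s), with gamma a tuple of length n.+1. *)
Section GradedSimple.
Variables (F : fieldType) (G : groupType) (n : nat).
Variables (gamma : 'I_n.+1 -> G) (H : finsubgroup G) (s : cocycle2 H F).

Definition Malg : falgType F := mxalg (twgalg s) n.

Definition Mbasis (i j : 'I_n.+1) (h : H) : Malg :=
  mxtens (delta_mx i j) (twgalg_basis s h).

Definition Mdegree (i j : 'I_n.+1) (h : H) : G :=
  (gamma i * val h * (gamma j)^-1)%g.

Definition Mgrading (x : G) : {vspace Malg} :=
  (\sum_(p : 'I_n.+1 * 'I_n.+1 * H | Mdegree p.1.1 p.1.2 p.2 == x)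
     <[Mbasis p.1.1 p.1.2 p.2]>)%VS.

End GradedSimple.

Arguments Mbasis {F G} n {H} s i j h.
Arguments Mgrading {F G n} gamma {H} s x.
Arguments weakly_equivalent {F A B S T} gA gB.
Arguments implements_weak_equivalence {F A B S T} gA gB phi.

Section ConditionStar.
Variables (F : fieldType) (G1 G2 : groupType) (n1 n2 : nat).
Variables (gamma1 : 'I_n1.+1 -> G1) (gamma2 : 'I_n2.+1 -> G2).
Variables (H1 : finsubgroup G1) (H2 : finsubgroup G2).
Variables (s1 : cocycle2 H1 F) (s2 : cocycle2 H2 F).

(* The data (alpha, pi, t) satisfies the requirements of Condition star; as pi
   permutes the indices of gamma1, its values are transported along n1 = n2
   to index gamma2. *)
Definition star_data (e : n1.+1 = n2.+1) (alpha : {multiplicative H1 -> H2})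
    (pi : 'S_n1.+1) (t : 'I_n1.+1 -> H2) : Prop :=
  let g2 i := gamma2 (cast_ord e (pi i)) in
  [/\ bijective alpha,
      cohomologous s1 (cocycle_pullback alpha s2) &
      forall i j k l h1 h2,
        (g2 i * val (t i) * val (alpha h1) * (val (t j))^-1 * (g2 j)^-1 =
         g2 k * val (t k) * val (alpha h2) * (val (t l))^-1 * (g2 l)^-1)%g
        <->
        (gamma1 i * val h1 * (gamma1 j)^-1 =
         gamma1 k * val h2 * (gamma1 l)^-1)%g].

Definition condition_star : Prop :=
  exists e alpha pi t, star_data e alpha pi t.

(* phi (e_ij (x) x_h) =
     c_ijh (e_(pi i, pi j) (x) y_(t_i alpha(h) t_j^-1)). *)
Definition star_formula (e : n1.+1 = n2.+1) (alpha : {multiplicative H1 -> H2})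
    (pi : 'S_n1.+1) (t : 'I_n1.+1 -> H2) (c : 'I_n1.+1 -> 'I_n1.+1 -> H1 -> F)
    (phi : {lrmorphism Malg n1 s1 -> Malg n2 s2}) : Prop :=
  forall i j h, phi (Mbasis n1 s1 i j h) =
    c i j h *: Mbasis n2 s2 (cast_ord e (pi i)) (cast_ord e (pi j))
                 (t i * alpha h * (t j)^-1)%g.

(* Scalars for which [c_ijh y_(t_i alpha(h) t_j^-1)] is
   [tau(h) y_(t_i) y_(alpha(h)) y_(t_j)^-1]: see [twgalg_basis_conj]. *)
Definition star_scalar (alpha : {multiplicative H1 -> H2})
    (t : 'I_n1.+1 -> H2) (tau : H1 -> F) (i j : 'I_n1.+1) (h : H1) : F :=
  tau h * (s2 (t i) (alpha h) / s2 (t i * alpha h * (t j)^-1)%g (t j)).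

End ConditionStar.

Lemma twgalg_basis_conj (F : fieldType) (H : finGroupType) (s : cocycle2 H F)
    (a b c : H) :
  twgalg_basis s a * twgalg_basis s b / twgalg_basis s c =
  (s a b / s (a * b * c^-1)%g c) *: twgalg_basis s (a * b * c^-1)%g.
Proof.
apply: (mulIr (twgalg_basis_unit s c)); rewrite divrK ?twgalg_basis_unit //.
rewrite -scalerAl !twgalg_basisM scalerA divfK ?mulgVK //.
exact: cocycle2_neq0.
Qed.

(* Main.v *)
From HB Require Import structures.
Require Import Defs.
From mathcomp Require Import all_boot all_order all_algebra all_fingroup all_field.

Set Implicit Arguments.
Unset Strict Implicit.
Unset Printing Implicit Defensive.

Import GRing.Theory.
Local Open Scope ring_scope.

(** Write A and B for the two graded algebras, e_ij x_h and e_ij y_h for their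
    bases of homogeneous elements, e_i and f_j for the diagonal idempotents
    e_ii (x) 1 of A and of B, and g_i, g'_j for the entries of the two tuples.

    A map of the form e_ij x_h |-> c_ijh e_(pi i, pi j) y_(t_i alpha(h) t_j^-1)
    with nonzero scalars permutes the bases up to scaling, so it is bijective,
    and it carries components onto components exactly when equality of degrees
    is preserved and reflected, which is the last clause of Condition star
    ([monomial_weak_equivalence]).  With the scalars of [star_scalar] it is an
    algebra morphism because it is a composite of three: the isomorphism
    x_h |-> tau(h) y_(alpha h) applied entrywise, conjugation by the diagonal
    matrix of the units y_(t_i), and a permutation of the indices
    ([star_formula_exists]).

    Conversely let phi implement a weak equivalence.  The components of A are
    carried to components of B, so each basis vector e_ij x_h receives a degree
    theta(i, j, h) in G2, namely the degree of its image; theta separates basis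
    vectors of A exactly as their degrees in G1 do, and
    theta(i, j, g) theta(j, k, h) = theta(i, k, gh) because the product of the
    basis vectors is not zero.  It remains to put theta in the form
      theta(i, j, h) = w_i alpha(h) w_j^-1   with   w_i = g'_(pi i) t_i.

    The image e' = phi(e_0) is an idempotent of degree 1 with e' B_1 e' = F e',
    and the f_j have the same property and add up to 1.  Hence some e' f_j e' is
    a nonzero multiple of e', and e' and f = f_j are equivalent: e' = ab and
    f = ba for some a, b of degree 1 ([equivalent_idempotents]).  Then
    x |-> b phi(x) a is an isomorphism of the corner e_0 A e_0, a copy of the
    twisted group algebra of H1, onto f B f, a copy of that of H2, and it
    carries components onto components.  As the components of both are lines,
    it has the form x_h |-> c(h) y_(alpha h), which makes alpha an isomorphism
    and c a cochain whose coboundary relates the cocycles ([corner_mul],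
    [alpha_bij]).

    Likewise x |-> phi(x) a identifies the column A e_0 with B f, componentwise.
    In a column the component of a given degree has a dimension that counts the
    tuple entries lying in one left coset of the subgroup.  So the w_i and the
    g'_j are distributed in the same way over the left cosets of H2
    ([card_column]), and this yields both n1 = n2 and the permutation pi with
    w_i in g'_(pi i) H2 ([coset_matching]). *)

(** * The homogeneous basis and coordinates *)

Section Coordinates.
Variables (F : fieldType) (G : groupType) (n : nat).
Variables (gamma : 'I_n.+1 -> G) (H : finsubgroup G) (s : cocycle2 H F).
Local Notation M := (Malg n s).
Local Notation idx := ('I_n.+1 * 'I_n.+1 * H)%type.

Definition Mb (p : idx) : M := Mbasis n s p.1.1 p.1.2 p.2.
Definition Mdeg (p : idx) : G := Mdegree gamma p.1.1 p.1.2 p.2.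
Definition Mcoef (p : idx) (x : M) : F := (x : 'M[twgalg s]_n.+1) p.1.1 p.1.2 p.2.

Fact Mcoef_is_linear p : linear_for *%R (Mcoef p).
Proof. by move=> k x y; rewrite /Mcoef !mxE !ffunE. Qed.
HB.instance Definition _ p :=
  GRing.isLinear.Build F M F *%R (Mcoef p) (Mcoef_is_linear p).

Lemma McoefZ p k x : Mcoef p (k *: x) = k * Mcoef p x.
Proof. exact: linearZ. Qed.

Lemma Mcoef_basis p q : Mcoef p (Mb q) = (p == q)%:R.
Proof.
case: p q => [[i j] h] [[k l] h']; rewrite /Mcoef /Mb /Mbasis !mxE /= !ffunE.
rewrite !xpair_eqE; case: (i == k); case: (j == l); case: (h == h') => //=;
  rewrite [_ *: _]mulr_natl //.
Qed.

Lemma McoefP x y : (forall p, Mcoef p x = Mcoef p y) -> x = y.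
Proof.
move=> E; apply/matrixP=> i j; apply/ffunP=> h.
exact: (E (i, j, h)).
Qed.

Lemma Mcoef_sum p (I : finType) (P : pred I) (c : I -> F) (b : I -> M) :
  Mcoef p (\sum_(i | P i) c i *: b i) = \sum_(i | P i) c i * Mcoef p (b i).
Proof. by rewrite linear_sum /=; apply: eq_bigr => i _; rewrite McoefZ. Qed.

Lemma Mb_expand x : x = \sum_p Mcoef p x *: Mb p.
Proof.
apply: McoefP => p; rewrite Mcoef_sum (bigD1 p) //= big1 ?addr0.
  by rewrite Mcoef_basis eqxx mulr1.
by move=> q qp; rewrite Mcoef_basis eq_sym (negbTE qp) mulr0.
Qed.

Lemma Mb_neq0 p : Mb p != 0.
Proof.
apply/eqP => /(congr1 (Mcoef p)); rewrite Mcoef_basis eqxx linear0.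
by move/eqP; rewrite oner_eq0.
Qed.

Lemma Mb_mul i j k l g h : Mb (i, j, g) * Mb (k, l, h) =
  if j == k then s g h *: Mb (i, l, (g * h)%g) else 0.
Proof.
rewrite /Mb /= [LHS](@mxtensM F (twgalg s) n) [delta_mx i j * _]mul_delta_mx_cond.
rewrite twgalg_basisM; case: (j == k).
  by apply/matrixP=> a b; rewrite !mxE scalerA mulrC -scalerA.
by apply/matrixP=> a b; rewrite mulr0n !mxE scale0r.
Qed.

Lemma exists_Mcoef x : x != 0 -> exists p, Mcoef p x != 0.
Proof.
move=> x0; apply/existsP; apply: contraNT x0; rewrite negb_exists => /forallP E.
by apply/eqP/McoefP => p; rewrite linear0; apply/eqP; move: (E p); rewrite negbK.
Qed.

Definition Mspan (P : pred idx) : {vspace M} := (\sum_(p | P p) <[Mb p]>)%VS.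

Lemma mem_Mspan (P : pred idx) x :
  reflect (forall p, Mcoef p x != 0 -> P p) (x \in Mspan P).
Proof.
apply: (iffP idP) => [/memv_sumP [y yP ->] p | E].
  apply: contraNT => Pp; rewrite linear_sum big1 //= => q Pq.
  have /vlineP [k ->] := yP _ Pq.
  rewrite McoefZ Mcoef_basis; case: eqP => [pq|]; last by rewrite mulr0.
  by rewrite pq Pq in Pp.
rewrite [x]Mb_expand; apply: memv_suml => p _.
have [->|/E Pp] := eqVneq (Mcoef p x) 0; first by rewrite scale0r mem0v.
by apply/memvZ/(subvP (sumv_sup p Pp (subvv _)))/memv_line.
Qed.

Lemma dim_Mspan (P : pred idx) : \dim (Mspan P) = #|P|.
Proof.
have: directv (Mspan P).
  apply/directv_sum_independent => u uP E p Pp.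
  have /vlineP [k uk] := uP _ Pp.
  move/(congr1 (Mcoef p)): E; rewrite linear0 linear_sum (bigD1 p) //= big1.
    by rewrite addr0 uk McoefZ Mcoef_basis eqxx mulr1 => ->; rewrite scale0r.
  move=> q /andP[/uP /vlineP [k' ->] qp].
  by rewrite McoefZ Mcoef_basis eq_sym (negbTE qp) mulr0.
move/directvP => /= ->; rewrite -sum1_card; apply: eq_bigr => p _.
by rewrite dim_vline Mb_neq0.
Qed.

Lemma MgradingE g : Mgrading gamma s g = Mspan [pred p | Mdeg p == g].
Proof. by []. Qed.

Lemma mem_Mgrading g x :
  reflect (forall p, Mcoef p x != 0 -> Mdeg p = g) (x \in Mgrading gamma s g).
Proof.
by apply: (iffP (mem_Mspan _ _)) => E p /E; [move/eqP | move=> <-; exact: eqxx].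
Qed.

Lemma Mb_grading p : Mb p \in Mgrading gamma s (Mdeg p).
Proof.
apply/mem_Mgrading => q; rewrite Mcoef_basis.
by have [->//|_] := eqVneq q p; rewrite eqxx.
Qed.

Lemma Mgrading_inj g h x : x != 0 ->
  x \in Mgrading gamma s g -> x \in Mgrading gamma s h -> g = h.
Proof.
by move=> /exists_Mcoef [p px] /mem_Mgrading/(_ _ px) <- /mem_Mgrading/(_ _ px) <-.
Qed.

Lemma Mdeg1 i : Mdeg (i, i, 1%g) = 1%g.
Proof. by rewrite /Mdeg /Mdegree /= mulg1 mulgV. Qed.

Lemma Mdeg_inj i j g h : Mdeg (i, j, g) = Mdeg (i, j, h) -> g = h.
Proof. by move/mulIg/mulgI => E; apply: val_inj. Qed.

Lemma Mdeg_mul i j k g h : (Mdeg (i, j, g) * Mdeg (j, k, h))%g = Mdeg (i, k, g * h)%g.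
Proof. by rewrite /Mdeg /Mdegree /= !mulgA mulgVK. Qed.

Lemma Mgrading_mul g h x y : x \in Mgrading gamma s g -> y \in Mgrading gamma s h ->
  x * y \in Mgrading gamma s (g * h)%g.
Proof.
move=> /mem_Mgrading xg /mem_Mgrading yh.
rewrite [x]Mb_expand mulr_suml; apply: rpred_sum => p _.
have [->|/xg <-] := eqVneq (Mcoef p x) 0; first by rewrite scale0r mul0r mem0v.
rewrite [y]Mb_expand mulr_sumr; apply: rpred_sum => q _.
have [->|/yh <-] := eqVneq (Mcoef q y) 0; first by rewrite scale0r mulr0 mem0v.
rewrite -scalerAl -scalerAr; do 2 apply: memvZ.
case: p q => [[i j] a] [[k l] b]; rewrite Mb_mul; case: eqP => [->|_].
  by rewrite Mdeg_mul memvZ ?Mb_grading.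
exact: mem0v.
Qed.

(** The factor 1 is the unit of the twisted group algebra, which is only a
    multiple of the basis vector u_1 as the cocycle need not be normalized. *)
Definition Midem i : M := mxtens (delta_mx i i) 1.

Lemma Midem_Mb i : Midem i = (s 1%g 1%g)^-1 *: Mb (i, i, 1%g).
Proof. by apply/matrixP=> a b; rewrite !mxE scalerA mulrC -scalerA. Qed.

Lemma Midem_mulr i x p : Mcoef p (x * Midem i) = if p.1.2 == i then Mcoef p x else 0.
Proof.
case: p => [[a b] h]; rewrite /Mcoef /= mxE (bigD1 i) //= big1 => [|c ci].
  rewrite !mxE eqxx /= addr0; case: eqP => [->|_]; first by rewrite scale1r mulr1.
  by rewrite scale0r mulr0 ffunE.
by rewrite !mxE (negbTE ci) /= scale0r mulr0.
Qed.

Lemma Midem_mull i x p : Mcoef p (Midem i * x) = if p.1.1 == i then Mcoef p x else 0.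
Proof.
case: p => [[a b] h]; rewrite /Mcoef /= mxE (bigD1 i) //= big1 => [|c ci].
  rewrite !mxE eqxx andbT addr0; case: eqP => [->|_]; first by rewrite scale1r mul1r.
  by rewrite scale0r mul0r ffunE.
by rewrite !mxE (negbTE ci) andbF scale0r mul0r.
Qed.

Lemma Midem_sum : \sum_i Midem i = 1.
Proof.
apply: McoefP => p.
rewrite -[\sum_i _]mul1r mulr_sumr linear_sum (bigD1 p.1.2) //= Midem_mulr eqxx.
by rewrite big1 ?addr0 // => i ip; rewrite Midem_mulr eq_sym (negbTE ip).
Qed.

Lemma Midem_sqr i : Midem i * Midem i = Midem i.
Proof.
rewrite [LHS](@mxtensM F (twgalg s) n) mulr1.
by rewrite [delta_mx i i * _]mul_delta_mx.
Qed.

(** For fixed i and j the degree g_i h g_j^-1 determines h, so the components of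
    e_i A e_j are lines. *)
Lemma Mcorner i j h x : x \in Mgrading gamma s (Mdeg (i, j, h)) ->
  Midem i * x * Midem j = Mcoef (i, j, h) x *: Mb (i, j, h).
Proof.
move=> /mem_Mgrading xg; apply: McoefP => -[[k l] h'].
rewrite Midem_mulr Midem_mull McoefZ Mcoef_basis !xpair_eqE /=.
case: eqP => [->|]; last by rewrite andbF mulr0.
case: eqP => [->|]; last by rewrite mulr0.
have [->|hh] := eqVneq h' h; rewrite ?mulr1 //= mulr0.
by apply: contraNeq hh => /xg /Mdeg_inj ->.
Qed.

Lemma Midem_grading i : Midem i \in Mgrading gamma s 1%g.
Proof. by rewrite Midem_Mb memvZ // -(Mdeg1 i) Mb_grading. Qed.

(** This makes e_i a primitive idempotent of the identity component A_1, with
    e_i A_1 e_i = F e_i. *)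
Lemma Midem_corner i x : x \in Mgrading gamma s 1%g ->
  exists c, Midem i * x * Midem i = c *: Midem i.
Proof.
rewrite -(Mdeg1 i) => /Mcorner ->; exists (Mcoef (i, i, 1%g) x * s 1%g 1%g).
by rewrite Midem_Mb scalerA mulfK // cocycle2_neq0.
Qed.

Lemma Midem_neq0 i : Midem i != 0.
Proof. by rewrite Midem_Mb scaler_eq0 negb_or invr_eq0 cocycle2_neq0 Mb_neq0. Qed.

Lemma Mb_Midem i j h : Mb (i, j, h) * Midem j = Mb (i, j, h).
Proof.
apply: McoefP => p; rewrite Midem_mulr; case: eqP => // pj.
by rewrite Mcoef_basis; case: eqP => // pE; rewrite pE in pj.
Qed.

Lemma mem_Mgrading_column j d x :
  x \in Mspan [pred q | (Mdeg q == d) && (q.1.2 == j)] <->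
  x \in Mgrading gamma s d /\ x * Midem j = x.
Proof.
split=> [/mem_Mspan xP | [/mem_Mgrading xd xj]].
  split; first by apply/mem_Mgrading => q /xP /andP[/eqP].
  apply: McoefP => q; rewrite Midem_mulr; case: eqP => // qj.
  by have [-> //|/xP /andP[_ /eqP]] := eqVneq (Mcoef q x) 0.
apply/mem_Mspan => q xq /=; rewrite xd // eqxx /=.
by apply: contraNT xq => qj; rewrite -xj Midem_mulr (negbTE qj).
Qed.
End Coordinates.

(** * From the explicit formula to a weak equivalence *)

Section Monomial.
Variables (F : fieldType) (G1 G2 : groupType) (n1 n2 : nat).
Variables (gamma1 : 'I_n1.+1 -> G1) (gamma2 : 'I_n2.+1 -> G2).
Variables (H1 : finsubgroup G1) (H2 : finsubgroup G2).
Variables (s1 : cocycle2 H1 F) (s2 : cocycle2 H2 F).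
Local Notation idx1 := ('I_n1.+1 * 'I_n1.+1 * H1)%type.
Local Notation idx2 := ('I_n2.+1 * 'I_n2.+1 * H2)%type.

Lemma monomial_weak_equivalence (phi : {lrmorphism Malg n1 s1 -> Malg n2 s2})
    (f : idx1 -> idx2) (c : idx1 -> F) :
    bijective f -> (forall p, c p != 0) ->
    (forall p, phi (Mb s1 p) = c p *: Mb s2 (f p)) ->
    (forall p q, Mdeg gamma2 (f p) = Mdeg gamma2 (f q) <->
                 Mdeg gamma1 p = Mdeg gamma1 q) ->
  implements_weak_equivalence (Mgrading gamma1 s1) (Mgrading gamma2 s2) phi.
Proof.
move=> f_bij c0 phiE degE; have [f' fK f'K] := f_bij; split.
  pose psi (y : Malg n2 s2) : Malg n1 s1 :=
    \sum_p ((c p)^-1 * Mcoef (f p) y) *: Mb s1 p.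
  exists psi => [x | y].
    rewrite {1}[x]Mb_expand linear_sum [RHS]Mb_expand; apply: eq_bigr => p _.
    rewrite linear_sum (bigD1 p) //= big1 ?addr0 => [|q qp].
      by rewrite linearZ /= phiE !linearZ /= Mcoef_basis eqxx mulr1 [_ * c p]mulrC mulKf.
    rewrite linearZ /= phiE !linearZ /= Mcoef_basis (bij_eq f_bij) eq_sym (negbTE qp).
    by rewrite !mulr0.
  rewrite linear_sum [RHS]Mb_expand (reindex f) /=; last exact: onW_bij.
  by apply: eq_bigr => p _; rewrite linearZ /= phiE scalerA mulrAC mulVf ?mul1r.
move=> g Ag0.
have [p /eqP p_g]: exists p : idx1, Mdeg gamma1 p == g.
  apply/existsP; apply: contraNT Ag0; rewrite negb_exists => /forallP E.
  by rewrite /Mgrading big1 // => p Dp; case/negP: (E p).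
exists (Mdeg gamma2 (f p)); rewrite !MgradingE /Mspan limg_sum.
rewrite [RHS](reindex f) /=; last exact: onW_bij.
apply: eq_big => [q | q _].
  by apply/eqP/eqP; rewrite -p_g degE.
rewrite limg_line lfunE /= phiE; apply: subv_anti; rewrite -!memvE memvZ ?memv_line //=.
by rewrite -[X in X \in _]scale1r -(mulVf (c0 q)) -scalerA memvZ ?memv_line.
Qed.

Definition star_index (e : n1.+1 = n2.+1) (alpha : H1 -> H2) (pi : 'S_n1.+1)
    (t : 'I_n1.+1 -> H2) (p : idx1) : idx2 :=
  (cast_ord e (pi p.1.1), cast_ord e (pi p.1.2),
   (t p.1.1 * alpha p.2 * (t p.1.2)^-1)%g).

Lemma star_index_bij e alpha pi t : bijective alpha ->
  bijective (star_index e alpha pi t).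
Proof.
move=> [beta alphaK betaK]; pose r i := (pi^-1)%g (cast_ord (esym e) i).
have rK i : r (cast_ord e (pi i)) = i by rewrite /r cast_ordK permK.
have rK' i : cast_ord e (pi (r i)) = i by rewrite /r permKV cast_ordKV.
exists (fun q => (r q.1.1, r q.1.2, beta ((t (r q.1.1))^-1 * q.2 * t (r q.1.2))%g)).
  by move=> [[i j] h]; rewrite /star_index /= !rK !mulgA mulVg mul1g mulgVK alphaK.
by move=> [[i j] h]; rewrite /star_index /= !rK' betaK mulgA mulVKg mulgK.
Qed.

Lemma star_weak_equivalence e (alpha : {multiplicative H1 -> H2}) pi t c
    (phi : {lrmorphism Malg n1 s1 -> Malg n2 s2}) :
  star_data gamma1 gamma2 s1 s2 e alpha pi t ->
  (forall i j h, c i j h != 0) -> star_formula e alpha pi t c phi ->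
  implements_weak_equivalence (Mgrading gamma1 s1) (Mgrading gamma2 s2) phi.
Proof.
move=> [alpha_bij _ degE] c0 phiE.
apply: (@monomial_weak_equivalence phi (star_index e alpha pi t)
          (fun p => c p.1.1 p.1.2 p.2)) => //.
- exact: star_index_bij.
- by move=> p; rewrite /Mb phiE.
move=> [[i j] h] [[k l] h']; have := degE i j k l h h'.
by rewrite /Mdeg /Mdegree /= !mulgA.
Qed.
End Monomial.

(** * The algebra morphism given by the formula *)

Section StarMorphism.
Variables (F : fieldType) (K1 K2 : finGroupType).
Variables (s1 : cocycle2 K1 F) (s2 : cocycle2 K2 F).
Variables (alpha : {multiplicative K1 -> K2}) (beta : K2 -> K1) (tau : K1 -> F).
Hypotheses (alphaK : cancel alpha beta) (betaK : cancel beta alpha).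
Hypothesis tauP : cobounds s1 (cocycle_pullback alpha s2) tau.

Definition twgalg_map (x : twgalg s1) : twgalg s2 :=
  [ffun k => tau (beta k) * x (beta k)].

Lemma twgalg_map_linear : linear twgalg_map.
Proof.
move=> k x y; apply/ffunP=> a; rewrite !ffunE.
by rewrite mulrDr [k *: x _]/(k * x _) mulrCA.
Qed.

Lemma twgalg_map_basis h :
  twgalg_map (twgalg_basis s1 h) = tau h *: twgalg_basis s2 (alpha h).
Proof.
apply/ffunP=> k; rewrite !ffunE (can2_eq betaK alphaK).
by case: eqP => [->|_]; rewrite ?alphaK // mulr0 [_ *: _]mulr0.
Qed.

(** In coordinates, multiplicativity on basis vectors is the relation
    s1 g h * tau (gh) = s2 (alpha g) (alpha h) * (tau g * tau h). *)
Lemma twgalg_mapM : {morph twgalg_map : x y / x * y}.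
Proof.
have [tau0 tauE] := tauP.
move=> x y; apply/ffunP=> k; rewrite !ffunE mulr_sumr.
rewrite (reindex beta) /=; last by apply: onW_bij; exists alpha.
apply: eq_bigr => g _; rewrite !ffunE.
set a := beta g; have <-: beta (g^-1 * k)%g = (a^-1 * beta k)%g.
  by apply: (mulgI a); apply: (can_inj alphaK); rewrite mulKVg gmulfM /a !betaK mulKVg.
set b := beta (g^-1 * k)%g; have ->: beta k = (a * b)%g.
  by apply: (can_inj alphaK); rewrite betaK gmulfM /a /b !betaK mulVKg.
rewrite tauE /= /a /b !betaK -/a -/b.
rewrite [in RHS]mulrACA [RHS]mulrA mulrA; congr (_ * _).
by rewrite mulrC -!mulrA mulVf // mulr1.
Qed.

Lemma twgalg_map1 : twgalg_map 1 = 1.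
Proof.
have [tau0 tauE] := tauP.
suff: twgalg_map (twgalg_one s1) = twgalg_one s2 by [].
have alpha1: alpha 1%g = 1%g by apply: (mulgI (alpha 1%g)); rewrite -gmulfM !mulg1.
have twZ a x : twgalg_map (a *: x) = a *: twgalg_map x.
  apply/ffunP=> k; rewrite !ffunE.
  by rewrite [a *: x _]/(a * x _) mulrCA.
rewrite /twgalg_one twZ twgalg_map_basis scalerA alpha1 tauE /= mulg1 alpha1.
by rewrite mulfK // invfM mulfVK.
Qed.

Definition twgalg_morph : {lrmorphism twgalg s1 -> twgalg s2} :=
  HB.pack twgalg_map
    (GRing.isLinear.Build F (twgalg s1) (twgalg s2) *:%R twgalg_map twgalg_map_linear)
    (GRing.isMonoidMorphism.Build (twgalg s1) (twgalg s2) twgalg_map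
       (conj twgalg_map1 twgalg_mapM)).

Lemma twgalg_morph_basis h :
  twgalg_morph (twgalg_basis s1 h) = tau h *: twgalg_basis s2 (alpha h).
Proof. exact: twgalg_map_basis. Qed.
End StarMorphism.

Section ConjMorphism.
Variables (F : fieldType) (A B : falgType F) (m n : nat).
Variables (f : {lrmorphism A -> B}) (u : 'I_m.+1 -> B).
Variables (r : 'I_n.+1 -> 'I_m.+1) (r' : 'I_m.+1 -> 'I_n.+1).
Hypotheses (rK : cancel r r') (r'K : cancel r' r).
Hypothesis u_unit : forall i, u i \is a GRing.unit.

(** A morphism applied entrywise, then conjugation by the diagonal matrix of the
    u_i, then the permutation r' of the indices. *)
Definition mx_conj (x : mxalg A m) : mxalg B n :=
  \matrix_(i, j) (u (r i) * f (x (r i) (r j)) / u (r j)).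

Lemma mx_conj_linear : linear mx_conj.
Proof.
move=> k x y; apply/matrixP=> i j; rewrite !mxE linearP mulrDr mulrDl.
by rewrite -scalerAr -scalerAl.
Qed.

Lemma mx_conjM : {morph mx_conj : x y / x * y}.
Proof.
move=> x y; apply/matrixP=> i j; rewrite !mxE rmorph_sum mulr_sumr mulr_suml.
rewrite (reindex r) /=; last by apply: onW_bij; exists r'.
by apply: eq_bigr => k _; rewrite !mxE rmorphM !mulrA mulrVK.
Qed.

Lemma mx_conj1 : mx_conj 1 = 1.
Proof.
apply/matrixP=> i j; rewrite !mxE (can_eq rK).
by case: eqP => [->|_]; rewrite ?rmorph1 ?mulr1 ?divrr // rmorph0 mulr0 mul0r.
Qed.

Definition mx_conj_morph : {lrmorphism mxalg A m -> mxalg B n} :=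
  HB.pack mx_conj
    (GRing.isLinear.Build F (mxalg A m) (mxalg B n) *:%R mx_conj mx_conj_linear)
    (GRing.isMonoidMorphism.Build (mxalg A m) (mxalg B n) mx_conj
       (conj mx_conj1 mx_conjM)).

Lemma mx_conj_morph_tens i j a : mx_conj_morph (mxtens (delta_mx i j) a) =
  mxtens (delta_mx (r' i) (r' j)) (u i * f a / u j).
Proof.
apply/matrixP=> k l; rewrite !mxE.
rewrite !(can2_eq rK r'K).
case: eqP => [->|_]; last by rewrite !scale0r rmorph0 mulr0 mul0r.
case: eqP => [->|_]; last by rewrite !scale0r rmorph0 mulr0 mul0r.
by rewrite !r'K !scale1r.
Qed.
End ConjMorphism.

Section StarExists.
Variables (F : fieldType) (G1 G2 : groupType) (n1 n2 : nat).
Variables (H1 : finsubgroup G1) (H2 : finsubgroup G2).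
Variables (s1 : cocycle2 H1 F) (s2 : cocycle2 H2 F).

Lemma star_formula_exists e (alpha : {multiplicative H1 -> H2}) pi t tau :
  bijective alpha -> cobounds s1 (cocycle_pullback alpha s2) tau ->
  exists phi : {lrmorphism Malg n1 s1 -> Malg n2 s2},
    star_formula e alpha pi t (star_scalar s2 alpha t tau) phi.
Proof.
move=> [beta alphaK betaK] tauP.
pose r i := (pi^-1)%g (cast_ord (esym e) i).
pose r' i := cast_ord e (pi i).
have r'K : cancel r' r by move=> i; rewrite /r /r' cast_ordK permK.
have rK : cancel r r' by move=> i; rewrite /r /r' permKV cast_ordKV.
have u_unit i : twgalg_basis s2 (t i) \is a GRing.unit.
  exact: twgalg_basis_unit.
exists (mx_conj_morph (twgalg_morph alphaK betaK tauP) rK r'K u_unit) => i j h.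
rewrite /Mbasis mx_conj_morph_tens twgalg_morph_basis.
rewrite -scalerAr -scalerAl twgalg_basis_conj scalerA.
by apply/matrixP=> k l; rewrite !mxE scalerA mulrC -scalerA.
Qed.
End StarExists.

(** * Matching two families by their left cosets *)

Section CosetMatching.
Variables (G : groupType) (H : finsubgroup G).

(** For each index i there is at most one k in H with w_i k = g_j, and there is
    one exactly if w_i and g_j lie in the same left coset of H.  The cardinals
    in the hypothesis thus count the entries of w and of g in the coset of g_j,
    and two families which meet every coset equally often differ by a
    permutation of the indices and by elements of H. *)
Lemma coset_matching m n (w : 'I_m -> G) (g : 'I_n -> G) :
    (forall i, exists l (k : H), w i = (g l * val k)%g) ->
    (forall j, #|[pred q : 'I_m * H | w q.1 * val q.2 == g j]%g|
             = #|[pred q : 'I_n * H | g q.1 * val q.2 == g j]%g|) ->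
  exists (e : m = n) (pi : 'S_m) (t : 'I_m -> H),
    forall i, w i = (g (cast_ord e (pi i)) * val (t i))%g.
Proof.
move=> w_g card_wg; pose same (x y : G) := [exists k : H, x * val k == y]%g.
have sameP x y : reflect (exists k : H, x * val k = y)%g (same x y).
  by apply: (iffP existsP) => -[k /eqP]; exists k => //; apply/eqP.
(* On the cosets that meet the family g, the set of indices l with g_l in the
   coset of x is a label which takes values in a finite type and separates
   these cosets. *)
pose lab x := [set l | same x (g l)].
have lab_g x j : (lab x == lab (g j)) = same x (g j).
  apply/eqP/idP => [E | /sameP [k xk]].
    suff: j \in lab x by rewrite inE.
    by rewrite E inE; apply/sameP; exists 1%g; rewrite val1 mulg1.
  apply/setP=> l; rewrite !inE -xk; apply/sameP/sameP => -[k' xk'].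
    by exists (k^-1 * k')%g; rewrite -xk' /= mulgA mulgK.
  by exists (k * k')%g; rewrite -xk' /= mulgA.
have card_same r (v : 'I_r -> G) x :
    #|[pred q : 'I_r * H | v q.1 * val q.2 == x]%g| = #|[pred i | same (v i) x]|.
  rewrite -(card_in_image (f := fst)).
    apply: eq_card => i; rewrite inE; apply/imageP/sameP.
      by case=> -[i' k] /= /eqP <- ->; exists k.
    by case=> k E; exists (i, k) => //; apply/eqP.
  move=> [i k] [i' k'] /eqP /= E /eqP /= E' ii; rewrite ii in E *.
  by congr (_, _); apply/val_inj/(mulgI (v i')); rewrite E.
have count_lab r (v : 'I_r -> G) j :
    count_mem (lab (g j)) (codom (lab \o v)) = #|[pred i | same (v i) (g j)]|.
  rewrite codomE count_map cardE enumT size_filter -enumT.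
  by apply: eq_count => i; rewrite /= lab_g.
have perm_lab : perm_eq (codom (lab \o w)) (codom (lab \o g)).
  apply/allP => x; rewrite mem_cat => xwg.
  have [j ->]: exists j, x = lab (g j).
    case/orP: xwg => /codomP [i ->]; last by exists i.
    have [l [k wE]] := w_g i; exists l; apply/eqP; rewrite /= lab_g.
    by apply/sameP; exists k^-1%g; rewrite wE /= mulgK.
  by rewrite /= !count_lab -!card_same card_wg.
have mn : m = n by have := perm_size perm_lab; rewrite !size_codom !card_ord.
subst n.
have codom_tupleE (v : 'I_m -> G) : codom (lab \o v) = [tuple lab (v i) | i < m].
  by rewrite codomE -val_ord_tuple.
move: perm_lab; rewrite !codom_tupleE => /tuple_permP [pi /val_inj labE].
have labi i : exists k : H, w i = (g (pi i) * val k)%g.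
  have : same (w i) (g (pi i)).
    rewrite -lab_g; apply/eqP; have := congr1 (fun s => tnth s i) labE.
    by rewrite !tnth_mktuple.
  by case/sameP=> k <-; exists k^-1%g; rewrite /= mulgK.
have [t tE] := fin_all_exists labi.
by exists erefl, pi, t => i; rewrite cast_ord_id.
Qed.
End CosetMatching.

Lemma card_fixed_column n (H : finType) (P : pred ('I_n * 'I_n * H)) j :
  #|[pred p | P p && (p.1.2 == j)]| = #|[pred r : 'I_n * H | P (r.1, j, r.2)]|.
Proof.
rewrite -(card_image (f := fun r : 'I_n * H => (r.1, j, r.2))).
  apply: eq_card => -[[i k] h]; rewrite inE /=; apply/andP/imageP.
    by case=> Pp /eqP kj; exists (i, h); rewrite ?inE -?kj.
  by case=> -[i' h'] Pr [-> -> ->]; split.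
by move=> [i h] [i' h'] [-> ->].
Qed.

(** * The degree map of a weak equivalence *)

Section FromWeakEquivalence.
Variables (F : fieldType) (G1 G2 : groupType) (n1 n2 : nat).
Variables (gamma1 : 'I_n1.+1 -> G1) (gamma2 : 'I_n2.+1 -> G2).
Variables (H1 : finsubgroup G1) (H2 : finsubgroup G2).
Variables (s1 : cocycle2 H1 F) (s2 : cocycle2 H2 F).
Local Notation idx1 := ('I_n1.+1 * 'I_n1.+1 * H1)%type.
Local Notation idx2 := ('I_n2.+1 * 'I_n2.+1 * H2)%type.
Local Notation gr1 := (Mgrading gamma1 s1).
Local Notation gr2 := (Mgrading gamma2 s2).
Local Notation deg1 := (Mdeg gamma1).
Local Notation deg2 := (Mdeg gamma2).

Variables (phi : {lrmorphism Malg n1 s1 -> Malg n2 s2}).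
Variables (psi : Malg n2 s2 -> Malg n1 s1) (theta : idx1 -> G2).
Hypotheses (phiK : cancel phi psi) (psiK : cancel psi phi).
Hypothesis thetaE : forall p, (linfun phi @: gr1 (deg1 p))%VS = gr2 (theta p).

Let phiM : {morph phi : x y / x * y}. Proof. exact: rmorphM. Qed.
Let phiZ k x : phi (k *: x) = k *: phi x. Proof. exact: linearZ. Qed.

Lemma phi_grading p x : (phi x \in gr2 (theta p)) = (x \in gr1 (deg1 p)).
Proof.
rewrite -thetaE; apply/memv_imgP/idP => [[y yp]|xp]; last by exists x; rewrite ?lfunE.
by rewrite lfunE /= => /(can_inj phiK) ->.
Qed.

Lemma phi_neq0 x : (phi x != 0) = (x != 0).
Proof. by rewrite -(inj_eq (can_inj phiK)) linear0. Qed.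

Lemma theta_deg p q : theta p = theta q <-> deg1 p = deg1 q.
Proof.
have phi_p : phi (Mb s1 p) \in gr2 (theta p) by rewrite phi_grading Mb_grading.
split=> E; [apply: (Mgrading_inj (Mb_neq0 s1 p)) |
            apply: (@Mgrading_inj _ _ _ gamma2 _ _ _ _ (phi (Mb s1 p)))].
- exact: Mb_grading.
- by rewrite -phi_grading -E.
- by rewrite phi_neq0 Mb_neq0.
- by [].
by rewrite phi_grading -E Mb_grading.
Qed.

(** The product of the two basis vectors is a nonzero multiple of a third one,
    so the degree of its image can be read off in two ways. *)
Lemma theta_mul i j k g h :
  (theta (i, j, g) * theta (j, k, h))%g = theta (i, k, g * h)%g.
Proof.
apply: (@Mgrading_inj _ _ _ gamma2 _ _ _ _ (phi (Mb s1 (i, j, g) * Mb s1 (j, k, h)))).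
- by rewrite phi_neq0 Mb_mul eqxx scaler_eq0 negb_or cocycle2_neq0 Mb_neq0.
- by rewrite phiM; apply: Mgrading_mul; rewrite phi_grading Mb_grading.
by rewrite Mb_mul eqxx phi_grading memvZ ?Mb_grading.
Qed.

Lemma theta1 i : theta (i, i, 1%g) = 1%g.
Proof. by apply: (mulgI (theta (i, i, 1%g))); rewrite theta_mul !mulg1. Qed.

(** An element y of B is the combination of the homogeneous elements phi(e_ij x_h)
    whose coefficients are the coordinates of its preimage, so a degree that
    occurs in y is the degree of one of them. *)
Lemma theta_support y q : Mcoef q y != 0 ->
  exists2 p, theta p = deg2 q & Mcoef p (psi y) != 0.
Proof.
rewrite -{1}[y]psiK {1}[psi y]Mb_expand linear_sum => yq.
have [p /andP[/eqP tp cp] | none] := pickP [pred p | (theta p == deg2 q) &&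
    (Mcoef p (psi y) != 0)]; first by exists p.
case/eqP: yq; rewrite linear_sum big1 // => p _.
rewrite !linearZ /=; have [->|cp] := eqVneq (Mcoef p (psi y)) 0; first by rewrite mul0r.
apply/eqP; rewrite mulf_eq0 (negbTE cp) /=.
apply/negPn/negP => phiq; have := none p; rewrite /= cp andbT => /eqP; apply.
have /mem_Mgrading/(_ _ phiq) -> // : phi (Mb s1 p) \in gr2 (theta p).
by rewrite phi_grading Mb_grading.
Qed.

(** * Equivalent idempotents and the corner isomorphism *)

Local Notation E := (phi (Midem s1 ord0)).

Lemma image_idempotent_grading : E \in gr2 1%g.
Proof. by rewrite -(theta1 ord0) phi_grading Mdeg1 Midem_grading. Qed.

(** Since E = E (sum_j f_j) E, some E f_j E is nonzero.  Both E f E = la E and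
    f E f = mu f hold by primitivity, and evaluating f E f E in two ways gives
    la = mu, so that E f and la^-1 f E are mutually inverse between E and f. *)
Lemma equivalent_idempotents : exists j a b,
  [/\ a * b = E, b * a = Midem s2 j, E * a = a, b * E = b &
      a \in gr2 1%g /\ b \in gr2 1%g].
Proof.
have EE : E * E = E by rewrite -phiM Midem_sqr.
have [j EfE]: exists j, E * Midem s2 j * E != 0.
  apply/existsP; apply: contraT; rewrite negb_exists => /forallP none.
  have /negP[] : E != 0 by rewrite phi_neq0 Midem_neq0.
  rewrite -EE -[X in X * _]mulr1 -(Midem_sum _ s2) mulr_sumr mulr_suml.
  by rewrite big1 // => j _; apply/eqP/negPn/none.
set f := Midem s2 j in EfE.
have f1 : f \in gr2 1%g by exact: Midem_grading.
have ff : f * f = f by exact: Midem_sqr.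
have [la laE] : exists la, E * f * E = la *: E.
  have f1' : psi f \in gr1 1%g.
    by rewrite -(Mdeg1 gamma1 H1 ord0) -phi_grading psiK theta1.
  have [c cE] := Midem_corner ord0 f1'; exists c.
  by rewrite -[f]psiK -!phiM cE phiZ.
have [mu muE] := Midem_corner j image_idempotent_grading; rewrite -/f in muE.
have la0 : la != 0 by apply: contraNneq EfE => la0; rewrite laE la0 scale0r.
have la_mu : mu = la.
  have fE0 : f * E != 0 by apply: contraNneq EfE => fE; rewrite -mulrA fE mulr0.
  have : mu *: (f * E) = la *: (f * E).
    by rewrite scalerAl -muE scalerAr -laE !mulrA.
  move/eqP; rewrite -subr_eq0 -scalerBl scaler_eq0 (negbTE fE0) orbF subr_eq0.
  by move/eqP.
exists j, (E * f), (la^-1 *: (f * E)); split.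
- by rewrite -scalerAr mulrA -[E * f * f]mulrA ff laE scalerA mulVf ?scale1r.
- by rewrite -scalerAl mulrA -[f * E * E]mulrA EE muE la_mu scalerA mulVf ?scale1r.
- by rewrite mulrA EE.
- by rewrite -scalerAl -mulrA EE.
have := image_idempotent_grading; rewrite -[1%g]mulg1 => E1; split.
  by apply: Mgrading_mul f1; rewrite -[1%g]mulg1.
by rewrite memvZ //; apply: Mgrading_mul f1 _; rewrite -[1%g]mulg1.
Qed.

Section Corner.
Variables (j0 : 'I_n2.+1) (a b : Malg n2 s2).
Local Notation f := (Midem s2 j0).
Hypotheses (abE : a * b = E) (baf : b * a = f) (Ea : E * a = a) (bE : b * E = b).
Hypotheses (a1 : a \in gr2 1%g) (b1 : b \in gr2 1%g).

Lemma mulaf : a * f = a. Proof. by rewrite -baf mulrA abE. Qed.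
Lemma mulfb : f * b = b. Proof. by rewrite -baf -mulrA abE. Qed.

Lemma mul_phi_neq0 i h : phi (Mb s1 (i, ord0, h)) * a != 0.
Proof.
have: phi (Mb s1 (i, ord0, h)) * a * b != 0.
  by rewrite -mulrA abE -phiM phi_neq0 Mb_Midem Mb_neq0.
by apply: contraNneq => ->; rewrite mul0r.
Qed.

Lemma Midem_basis h :
  Midem s1 (ord0 : 'I_n1.+1) * Mb s1 (ord0, ord0, h) * Midem s1 ord0 =
  Mb s1 (ord0, ord0, h).
Proof. by rewrite (Mcorner (Mb_grading gamma1 s1 _)) Mcoef_basis eqxx scale1r. Qed.

Local Notation corner h :=
  (b * phi (Mb s1 ((ord0 : 'I_n1.+1), (ord0 : 'I_n1.+1), h)) * a).

Lemma corner_grading h : corner h \in gr2 (theta (ord0, ord0, h)).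
Proof.
rewrite -[theta _]mulg1; apply: Mgrading_mul => //.
rewrite -[theta _]mul1g; apply: Mgrading_mul => //.
by rewrite phi_grading Mb_grading.
Qed.

Lemma corner_fix h : f * corner h * f = corner h.
Proof. by rewrite !mulrA mulfb -[_ * a * f]mulrA mulaf. Qed.

Lemma corner_neq0 h : corner h != 0.
Proof.
apply/eqP => corner0; have /negP[] := mul_phi_neq0 ord0 h.
have -> : phi (Mb s1 (ord0, ord0, h)) * a = a * corner h.
  by rewrite !mulrA abE -phiM -[in RHS]Midem_basis !mulrA Midem_sqr Midem_basis.
by rewrite corner0 mulr0.
Qed.

(** The image of e_0 x_h e_0 is homogeneous and lies in f B f, whose components
    are lines spanned by basis vectors. *)
Lemma corner_basis : exists alpha : H1 -> H2, exists c : H1 -> F,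
  [/\ forall h, c h != 0,
      forall h, corner h = c h *: Mb s2 (j0, j0, alpha h) &
      forall h, theta (ord0, ord0, h) = deg2 (j0, j0, alpha h)].
Proof.
have ex h : exists k : H2, Mcoef (j0, j0, k) (corner h) != 0.
  have [[[i j] k]] := exists_Mcoef (corner_neq0 h).
  rewrite -{1}corner_fix Midem_mulr Midem_mull /=.
  have [->|_] := eqVneq j j0; last by rewrite eqxx.
  have [->|_] := eqVneq i j0; last by rewrite eqxx.
  by exists k.
have [alpha alphaE] := fin_all_exists ex.
have degE h : theta (ord0, ord0, h) = deg2 (j0, j0, alpha h).
  by have /mem_Mgrading/(_ _ (alphaE h)) := corner_grading h.
exists alpha, (fun h => Mcoef (j0, j0, alpha h) (corner h)); split=> // h.
rewrite -{1}corner_fix; apply: (@Mcorner _ _ _ gamma2).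
by rewrite -degE corner_grading.
Qed.

(** Both sides are dimensions: x |-> phi(x) a is a linear isomorphism from
    A_s e_0, with s the degree of p, onto B_(theta p) f, with inverse
    y |-> psi(y b). *)
Lemma card_column p :
  #|[pred p' : idx1 | (deg1 p' == deg1 p) && (p'.1.2 == ord0)]| =
  #|[pred q : idx2 | (deg2 q == theta p) && (q.1.2 == j0)]|.
Proof.
rewrite -(dim_Mspan s1) -(dim_Mspan s2); set V1 := Mspan s1 _; set V2 := Mspan s2 _.
pose L := (amulr a \o linfun phi)%VF.
have LE x : L x = phi x * a by rewrite /L !lfunE /= !lfunE.
rewrite -(@limg_dim_eq _ _ _ L V1).
  congr (\dim _); apply/vspaceP => y; apply/memv_imgP/idP.
    case=> x /mem_Mgrading_column [xp x0] ->; apply/mem_Mgrading_column.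
    rewrite LE -mulrA mulaf; split=> //.
    by rewrite -[theta p]mulg1; apply: Mgrading_mul => //; rewrite phi_grading.
  move=> /mem_Mgrading_column [yp yj].
  exists (psi (y * b)); last by rewrite LE psiK -mulrA baf.
  apply/mem_Mgrading_column; split.
    by rewrite -phi_grading psiK -[theta p]mulg1; apply: Mgrading_mul.
  by apply: (can_inj phiK); rewrite phiM psiK -mulrA bE.
apply/eqP; rewrite -subv0; apply/subvP => x.
rewrite memv_cap => /andP[/mem_Mgrading_column [_ x0]].
rewrite memv_ker LE memv0 => /eqP E0; apply/negPn.
by rewrite -phi_neq0 negbK -x0 phiM -abE mulrA E0 mul0r.
Qed.

Section CornerIsomorphism.
Variables (alpha : H1 -> H2) (c : H1 -> F).
Hypotheses (c0 : forall h, c h != 0)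
  (cornerE : forall h, corner h = c h *: Mb s2 (j0, j0, alpha h))
  (alpha_deg : forall h, theta (ord0, ord0, h) = deg2 (j0, j0, alpha h)).

(** Inserting ab = E between two factors shows that the corner map is
    multiplicative; comparing coefficients in
    c(g) c(h) y_(alpha g) y_(alpha h) = s1(g, h) c(gh) y_(alpha(gh)), whose two
    sides are nonzero multiples of basis vectors, gives both claims. *)
Lemma corner_mul g h : alpha (g * h)%g = (alpha g * alpha h)%g /\
  s1 g h = s2 (alpha g) (alpha h) * (c g * c h * (c (g * h)%g)^-1).
Proof.
have cornerM : corner g * corner h = s1 g h *: corner (g * h)%g.
  transitivity (b * (phi (Mb s1 (ord0, ord0, g)) * E * phi (Mb s1 (ord0, ord0, h))) * a).
    by rewrite -abE !mulrA.
  by rewrite -!phiM Mb_Midem Mb_mul eqxx phiZ -scalerAr -scalerAl.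
have cornerM_basis : (c g * c h * s2 (alpha g) (alpha h)) *:
      Mb s2 (j0, j0, (alpha g * alpha h)%g) =
    (s1 g h * c (g * h)%g) *: Mb s2 (j0, j0, alpha (g * h)%g).
  have MM := Mb_mul s2 j0 j0 j0 j0 (alpha g) (alpha h); rewrite eqxx in MM.
  rewrite -!scalerA -MM -(cornerE (g * h)%g) -cornerM (cornerE g) (cornerE h).
  by rewrite -[RHS]scalerAl; congr (_ *: _); rewrite -[RHS]scalerAr.
have := congr1 (Mcoef (j0, j0, (alpha g * alpha h)%g)) cornerM_basis.
rewrite !McoefZ !Mcoef_basis eqxx mulr1.
rewrite !xpair_eqE eqxx /=.
case: eqP => [<- E12|_]; last first.
  move/eqP; rewrite mulr0 !mulf_eq0.
  by rewrite !(negbTE (c0 _)) (negbTE (cocycle2_neq0 _ _ _)).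
split=> //; rewrite mulr1 in E12; apply: (mulIf (c0 (g * h)%g)).
by rewrite -E12 -[RHS]mulrA divfK // mulrC.
Qed.

(** Injectivity is that of theta on the corner.  For surjectivity, y_k in f B f
    is pulled back to a y_k b in E B E = phi(e_0 A e_0): its degree is that of
    y_k and equals theta(0, 0, h) for some h, which forces k = alpha(h). *)
Lemma alpha_bij : bijective alpha.
Proof.
have alpha_inj : injective alpha.
  move=> g h gh; have : theta (ord0, ord0, g) = theta (ord0, ord0, h).
    by rewrite !alpha_deg gh.
  by move/theta_deg/Mdeg_inj.
have alpha_surj k : exists h, alpha h == k.
  pose y := a * Mb s2 (j0, j0, k) * b.
  have y_grad : y \in gr2 (deg2 (j0, j0, k)).
    rewrite -[deg2 _]mulg1; apply: Mgrading_mul => //.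
    by rewrite -[deg2 _]mul1g; apply: Mgrading_mul => //; exact: Mb_grading.
  have [q yq] : exists q, Mcoef q y != 0.
    apply: exists_Mcoef; apply/eqP => y0.
    have /negP[] := Mb_neq0 s2 (j0, j0, k).
    have <- : b * y * a = Mb s2 (j0, j0, k).
      rewrite /y !mulrA baf -mulrA baf (Mcorner (Mb_grading gamma2 s2 _)).
      by rewrite Mcoef_basis eqxx scale1r.
    by rewrite y0 mulr0 mul0r.
  have [[[i j] h] th] := theta_support yq.
  have <- : Midem s1 ord0 * psi y * Midem s1 ord0 = psi y.
    by apply: (can_inj phiK); rewrite !phiM psiK /y !mulrA Ea -mulrA bE.
  rewrite Midem_mulr Midem_mull /=.
  have [ej|_] := eqVneq j ord0; last by rewrite eqxx.
  have [ei _|_] := eqVneq i ord0; last by rewrite eqxx.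
  exists h; apply/eqP; move: th; rewrite ei ej alpha_deg.
  have /mem_Mgrading/(_ _ yq) -> := y_grad.
  exact: Mdeg_inj.
pose beta k := xchoose (alpha_surj k).
have betaK : cancel beta alpha by move=> k; apply/eqP/(xchooseP (alpha_surj k)).
by exists beta => // h; apply: alpha_inj; rewrite betaK.
Qed.

(** Factoring (i, j, h) as (i, 0, 1) (0, 0, h) (0, j, 1) gives
    theta(i, j, h) = w_i alpha(h) w_j^-1, and the column count moves each w_i
    into a coset g'_(pi i) H2. *)
Lemma corner_condition_star : condition_star gamma1 gamma2 s1 s2.
Proof.
pose w i := (theta (i, ord0, 1%g) * gamma2 j0)%g.
have theta_col i h : theta (i, ord0, h) = (w i * val (alpha h) * (gamma2 j0)^-1)%g.
  by rewrite -[in LHS](mul1g h) -(theta_mul _ ord0) alpha_deg /Mdeg /Mdegree /= !mulgA.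
have theta_w i j h : theta (i, j, h) = (w i * val (alpha h) * (w j)^-1)%g.
  have theta_row : theta (ord0, j, 1%g) = (theta (j, ord0, 1%g))^-1%g.
    by apply: (mulIg (theta (j, ord0, 1%g))); rewrite mulVg theta_mul mulg1 theta1.
  by rewrite -[in LHS](mulg1 h) -(theta_mul _ ord0) theta_col theta_row /w invgM !mulgA.
(* The image of e_i0 x_1 in B f is nonzero of degree w_i g'_j0^-1, and the
   degrees that occur in B f are the g'_l k g'_j0^-1. *)
have w_gamma i : exists l (k : H2), w i = (gamma2 l * val k)%g.
  have [[[l j] k] yq] := exists_Mcoef (mul_phi_neq0 i 1%g).
  have y_gr : phi (Mb s1 (i, ord0, 1%g)) * a \in gr2 (theta (i, ord0, 1%g)).
    rewrite -[theta _]mulg1; apply: Mgrading_mul => //.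
    by rewrite phi_grading Mb_grading.
  have /mem_Mgrading/(_ _ yq) degE := y_gr; move: yq.
  rewrite -mulaf mulrA Midem_mulr /=.
  have [jE _|_] := eqVneq j j0; last by rewrite eqxx.
  by exists l, k; rewrite /w -degE jE /Mdeg /Mdegree /= mulgVK.
(* The column count for the degree g'_j g'_j0^-1, in which (i, 0, h) lies if and
   only if w_i alpha(h) = g'_j. *)
have card_w j : #|[pred q : 'I_n1.+1 * H1 | w q.1 * val (alpha q.2) == gamma2 j]%g|
    = #|[pred q : 'I_n2.+1 * H2 | gamma2 q.1 * val q.2 == gamma2 j]%g|.
  have : Mcoef (j, j0, 1%g) (Mb s2 (j, j0, 1%g)) != 0.
    by rewrite Mcoef_basis eqxx oner_eq0.
  case/theta_support => p pE _.
  have := card_column p.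
  rewrite !card_fixed_column => card_p.
  transitivity #|[pred r : 'I_n1.+1 * H1 | deg1 (r.1, ord0, r.2) == deg1 p]|.
    apply: eq_card => -[i h]; rewrite !inE /=.
    apply/eqP/eqP => [E|/theta_deg]; last first.
      by rewrite pE theta_col /Mdeg /Mdegree /= mulg1 => /mulIg.
    by apply/theta_deg; rewrite pE theta_col E /Mdeg /Mdegree /= mulg1.
  rewrite {}card_p; apply: eq_card => -[l k]; rewrite !inE /= pE.
  by rewrite /Mdeg /Mdegree /= mulg1 (inj_eq (mulIg _)).
have card_alpha j : #|[pred q : 'I_n1.+1 * H2 | w q.1 * val q.2 == gamma2 j]%g|
    = #|[pred q : 'I_n1.+1 * H1 | w q.1 * val (alpha q.2) == gamma2 j]%g|.
  have [beta alphaK betaK] := alpha_bij.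
  rewrite -[RHS](card_image (f := fun q => (q.1, alpha q.2))); last first.
    by move=> [i h] [i' h'] [-> /(can_inj alphaK) ->].
  apply: eq_card => -[i k]; rewrite inE /=; apply/idP/imageP.
    by move=> E; exists (i, beta k); rewrite ?inE /= ?betaK.
  by case=> -[i' h] E [-> ->].
have [e [pi [t wE]]] := coset_matching w_gamma
  (fun j => etrans (card_alpha j) (card_w j)).
pose alphaH : {multiplicative H1 -> H2} :=
  HB.pack alpha (isMultiplicative.Build H1 H2 alpha (fun g h => (corner_mul g h).1)).
exists e, alphaH, pi, t; split.
- exact: alpha_bij.
- by exists c; split=> // g h; case: (corner_mul g h).
move=> i j k l h1 h2; rewrite -!wE.
have E u v h : (w u * val (alphaH h) * (val (t v))^-1 *
    (gamma2 (cast_ord e (pi v)))^-1)%g = theta (u, v, h).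
  by rewrite theta_w -!mulgA -invgM -wE.
by rewrite !E; exact: theta_deg.
Qed.
End CornerIsomorphism.
End Corner.
End FromWeakEquivalence.

(** * Weak equivalence and Condition star *)

Lemma weak_equivalence_star (F : fieldType) (G1 G2 : groupType) (n1 n2 : nat)
    (gamma1 : 'I_n1.+1 -> G1) (gamma2 : 'I_n2.+1 -> G2)
    (H1 : finsubgroup G1) (H2 : finsubgroup G2)
    (s1 : cocycle2 H1 F) (s2 : cocycle2 H2 F)
    (phi : {lrmorphism Malg n1 s1 -> Malg n2 s2}) :
  implements_weak_equivalence (Mgrading gamma1 s1) (Mgrading gamma2 s2) phi ->
  condition_star gamma1 gamma2 s1 s2.
Proof.
case=> -[psi phiK psiK] phi_gr.
have ex (p : 'I_n1.+1 * 'I_n1.+1 * H1) : exists t,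
    (linfun phi @: Mgrading gamma1 s1 (Mdeg gamma1 p))%VS = Mgrading gamma2 s2 t.
  apply: phi_gr; apply/eqP => gr0.
  by have := Mb_grading gamma1 s1 p; rewrite gr0 memv0 (negbTE (Mb_neq0 _ _)).
have [theta thetaE] := fin_all_exists ex.
have [j0 [a [b [abE baf Ea bE [a1 b1]]]]] := equivalent_idempotents phiK psiK thetaE.
have [alpha [c [c0 cornerE alpha_deg]]] :=
  corner_basis phiK thetaE abE baf Ea bE a1 b1.
exact: (corner_condition_star phiK psiK thetaE abE baf Ea bE a1 b1 c0 cornerE alpha_deg).
Qed.

Theorem theorem3p2 (F : fieldType) (G1 G2 : groupType) (n1 n2 : nat)
    (gamma1 : 'I_n1.+1 -> G1) (gamma2 : 'I_n2.+1 -> G2)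
    (H1 : finsubgroup G1) (H2 : finsubgroup G2)
    (s1 : cocycle2 H1 F) (s2 : cocycle2 H2 F) :
  (weakly_equivalent (Mgrading gamma1 s1) (Mgrading gamma2 s2) <->
     condition_star gamma1 gamma2 s1 s2)
  /\
  (forall (e : n1.+1 = n2.+1) (alpha : {multiplicative H1 -> H2})
      (pi : 'S_n1.+1) (t : 'I_n1.+1 -> H2),
    star_data gamma1 gamma2 s1 s2 e alpha pi t ->
    (forall tau : H1 -> F, cobounds s1 (cocycle_pullback alpha s2) tau ->
       exists phi : {lrmorphism Malg n1 s1 -> Malg n2 s2},
         star_formula e alpha pi t (star_scalar s2 alpha t tau) phi /\
         implements_weak_equivalence
           (Mgrading gamma1 s1) (Mgrading gamma2 s2) phi)
    /\
    (forall (c : 'I_n1.+1 -> 'I_n1.+1 -> H1 -> F)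
        (phi : {lrmorphism Malg n1 s1 -> Malg n2 s2}),
       (forall i j h, c i j h != 0) ->
       star_formula e alpha pi t c phi ->
       implements_weak_equivalence
         (Mgrading gamma1 s1) (Mgrading gamma2 s2) phi)).
Proof.
have formula_we e alpha pi t tau : star_data gamma1 gamma2 s1 s2 e alpha pi t ->
    cobounds s1 (cocycle_pullback alpha s2) tau ->
    exists phi : {lrmorphism Malg n1 s1 -> Malg n2 s2},
      star_formula e alpha pi t (star_scalar s2 alpha t tau) phi /\
      implements_weak_equivalence (Mgrading gamma1 s1) (Mgrading gamma2 s2) phi.
  move=> dat tauP; have [alpha_bij _ _] := dat; have [tau0 _] := tauP.
  have [phi phiE] := star_formula_exists e pi t alpha_bij tauP.
  exists phi; split=> //; apply: star_weak_equivalence dat _ phiE => i j h.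
  by rewrite !mulf_neq0 ?invr_eq0 ?cocycle2_neq0.
split; last first.
  move=> e alpha pi t dat; split=> [tau|c phi c0]; first exact: formula_we.
  exact: star_weak_equivalence.
split=> [[phi]|[e [alpha [pi [t dat]]]]]; first exact: weak_equivalence_star.
have [_ [tau tauP] _] := dat; have [phi [_ phi_we]] := formula_we _ _ _ _ _ dat tauP.
by exists phi.
Qed.
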